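(* For every integer $k\ge2$, the graph $\widehat Q_k$ is prime.
   Context: For $k\ge2$, $\widehat G_k$ is the graph with vertex set $\mathbb{N}\times\mathbb{N}$ in which $(x,y)$ and $(x',y')$ are adjacent iff either $x=x'$ and $|y-y'|=1$, or $x\ne x'$ and $y\not\equiv y'\pmod k$; $\widehat Q_k$ is its induced subgraph on $\{(n,m):m<n+5\}$. In a graph $G=(V,E)$, a set $A\subseteq V$ is a module (autonomous set) if every $v\notin A$ is either adjacent to all vertices of $A$ or to none. The empty set, singletons and $V$ are trivial modules. A graph is indecomposable if all its modules are trivial, and prime if it is indecomposable and has more than three vertices. *)

(* Defs.v *)
From mathcomp Require Import all_boot all_order ssralg ssrnum ssrint.
From mathcomp Require Import boolp classical_sets functions cardinality.
Set Implicit Arguments.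
Unset Strict Implicit.
Unset Printing Implicit Defensive.
Import IntDist.
Local Open Scope classical_set_scope.
Local Open Scope card_scope.

Record graph := Graph {
  vertex :> Type;
  adj : vertex -> vertex -> Prop;
  adj_sym : forall u v, adj u v -> adj v u;
  adj_irr : forall v, ~ adj v v
}.

Section Induced.
Variables (G : graph) (S : set G).

Definition induced_adj (u v : {x : G | S x}) := adj (sval u) (sval v).

Fact induced_sym u v : induced_adj u v -> induced_adj v u.
Proof. exact: adj_sym. Qed.

Fact induced_irr v : ~ induced_adj v v.
Proof. exact: adj_irr. Qed.

Definition induced := Graph induced_sym induced_irr.
End Induced.

Definition is_module (G : graph) (A : set G) :=
  forall v, ~ A v ->
    (forall a, A a -> adj v a) \/ (forall a, A a -> ~ adj v a).

Definition trivial_module (G : graph) (A : set G) :=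
  [\/ A = set0, exists v, A = [set v] | A = setT].

Definition indecomposable (G : graph) :=
  forall A : set G, is_module A -> trivial_module A.

Definition prime_graph (G : graph) :=
  indecomposable G /\ `I_4 #<= [set: G].

Section Ghat.
Variable k : nat.

Definition Ghat_adj (u v : nat * nat) : Prop :=
  (u.1 = v.1 /\ `|u.2 - v.2| = 1) \/ (u.1 <> v.1 /\ u.2 <> v.2 %[mod k]).

Fact Ghat_sym u v : Ghat_adj u v -> Ghat_adj v u.
Proof.
case=> -[h1 h2]; [left | right]; split; rewrite ?(distnC v.2) //;
  by [move=> e; apply: h1 | move=> e; apply: h2].
Qed.

Fact Ghat_irr v : ~ Ghat_adj v v.
Proof. by case=> -[]; rewrite ?distnn. Qed.

Definition Ghat := Graph Ghat_sym Ghat_irr.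

Definition Qhat := induced (G := Ghat) [set v : nat * nat | v.2 < v.1 + 5].
End Ghat.

(* Main.v *)
(** A subset containing two vertices [a], [b] is a module only if it contains
    every vertex adjacent to [a] but not to [b].  Applied repeatedly:
    - two vertices of one column generate the whole column, because a path on
      at least five vertices is prime, and a whole column generates the vertices
      at heights 0 and 1 of every other column, hence the whole graph;
    - two vertices in distinct columns with incongruent heights generate two
      vertices of any sufficiently long third column;
    - two vertices in distinct columns with congruent heights generate a second
      vertex in the longer column, at vertical distance 2 if [2 < k] and 3 if
      [k = 2]; the longer column has at least six vertices, so it has room. *)
Require Import Defs.
From mathcomp Require Import all_boot.
From mathcomp Require Import boolp classical_sets cardinality zify.

Set Implicit Arguments.
Unset Strict Implicit.
Unset Printing Implicit Defensive.

Lemma module_closed (G : graph) (A : set G) (a b v : G) :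
  is_module A -> A a -> A b -> adj v a -> ~ adj v b -> A v.
Proof.
move=> mA Aa Ab va vb; apply: contrapT => /mA [all_adj | no_adj].
- exact/vb/all_adj.
- exact: no_adj va.
Qed.

(** The closure property of [module_closed], read in the path on the heights below [L]. *)
Definition path_closed (L : nat) (P : nat -> Prop) :=
  forall a b w, P a -> P b -> w < L ->
    (w = a.+1 \/ a = w.+1) -> ~ (w = b.+1 \/ b = w.+1) -> P w.

Lemma path_closed_consecutive L P y : path_closed L P ->
  P y -> P y.+1 -> y.+1 < L -> forall w, w < L -> P w.
Proof.
move=> cP Py Py1 yL.
have up n : y.+1 + n < L -> P (y + n) /\ P (y.+1 + n).
  elim: n => [|n IHn] h; first by rewrite !addn0.
  have [|Pn Pn1] := IHn; first lia.
  split; first by rewrite addnS.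
  by apply: (cP _ _ _ Pn1 Pn); lia.
have down n : n <= y -> P (y - n) /\ P (y - n).+1.
  elim: n => [|n IHn] h; first by rewrite subn0.
  have [|Pn Pn1] := IHn; first lia.
  have e : (y - n.+1).+1 = y - n by lia.
  rewrite e; split=> //.
  by apply: (cP _ _ _ Pn Pn1); lia.
move=> w wL; case: (leqP w y) => wy.
  by rewrite -(subKn wy); apply: (down _ _).1; lia.
by rewrite -(subnKC wy); apply: (up _ _).2; lia.
Qed.

(** If [y] and [z] are not consecutive, a path neighbour of one that is not a neighbour of the other
    gives a consecutive pair: [z.+1], else [y.-1]. *)
Lemma path_closed_full L P y z : 5 <= L -> path_closed L P ->
  P y -> P z -> y < z -> z < L -> forall w, w < L -> P w.
Proof.
move=> L5 cP Py Pz yz zL.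
have [ez | nz] := eqVneq z y.+1.
  by apply: (path_closed_consecutive cP Py); rewrite -ez.
have [z1L | Lz] := ltnP z.+1 L.
  apply: (path_closed_consecutive cP Pz) => //.
  by apply: (cP _ _ _ Pz Py); lia.
case: y => [|y] in Py yz nz *.
  (* Here [y] and [z] are the two ends of the path, and 1 is adjacent to 0 only. *)
  apply: (path_closed_consecutive cP Py); last lia.
  by apply: (cP _ _ _ Py Pz); lia.
apply: (path_closed_consecutive (y := y) cP) => //; last lia.
by apply: (cP _ _ _ Py Pz); lia.
Qed.

Lemma Ghat_adj_column k x y z :
  Ghat_adj k (x, y) (x, z) <-> (y = z.+1 \/ z = y.+1).
Proof.
split=> [[[_] | [] //] /= | h]; first lia.
by left; split=> //=; lia.
Qed.

Lemma Ghat_adj_columns k x x' y z : x <> x' ->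
  Ghat_adj k (x, y) (x', z) <-> y <> z %[mod k].
Proof. by move=> xx'; split=> [[[] | []] | h] //; right. Qed.

Lemma modn_far_neq k y z : 2 <= k ->
  y + (if k == 2 then 3 else 2) = z -> y <> z %[mod k].
Proof.
move=> k2 <- /esym/eqP; rewrite eqn_mod_dvd ?leq_addr // addKn.
case: eqP => [->|] // k_neq2 /dvdn_leq; lia.
Qed.

Section ModulesOfQhat.
Variables (k : nat) (hk : 2 <= k) (A : set (Qhat k)).
Hypothesis mA : is_module A.

(** Quantifying over the bound proof allows reasoning on bare coordinates; proof irrelevance makes
    its choice immaterial. *)
Definition module_at (x y : nat) :=
  exists h : [set v : nat * nat | v.2 < v.1 + 5]%classic (x, y),
    A (exist _ (x, y) h).

Lemma module_atE (v : Qhat k) : module_at (sval v).1 (sval v).2 <-> A v.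
Proof.
case: v => [[x y] h] /=; split=> [[h']|]; last by exists h.
by rewrite (Prop_irrelevance h' h).
Qed.

Lemma module_at_lt x y : module_at x y -> y < x + 5.
Proof. by case. Qed.

Lemma module_at_closed x y x' y' c z : module_at x y -> module_at x' y' ->
  z < c + 5 -> Ghat_adj k (c, z) (x, y) -> ~ Ghat_adj k (c, z) (x', y') ->
  module_at c z.
Proof.
by move=> [h Ah] [h' Ah'] hz adj1 adj2; exists hz;
exact: (@module_closed (Qhat k) A _ _ (exist _ (c, z) hz) mA Ah Ah').
Qed.

Lemma module_at_column x y z : module_at x y -> module_at x z -> y <> z ->
  forall w, w < x + 5 -> module_at x w.
Proof.
have cP : path_closed (x + 5) (module_at x).
  move=> a b w Aa Ab wL wa wb.
  by apply: (module_at_closed Aa Ab wL); rewrite Ghat_adj_column.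
move=> Ay Az /eqP; rewrite neq_ltn => /orP[] lt_yz.
- by apply: (path_closed_full _ cP Ay Az) => //; [lia | exact: module_at_lt].
- by apply: (path_closed_full _ cP Az Ay) => //; [lia | exact: module_at_lt].
Qed.

Lemma module_at_column_full x y z : module_at x y -> module_at x z -> y <> z ->
  forall x' w, w < x' + 5 -> module_at x' w.
Proof.
move=> Ay Az yz x'; have Ax := module_at_column Ay Az yz.
have [->//|/eqP x'x] := eqVneq x' x.
have Ax0 : module_at x 0 by apply: Ax; lia.
have Ax1 : module_at x 1 by apply: Ax; lia.
have neq01 : 0 <> 1 %[mod k] by rewrite !modn_small //; lia.
apply: (@module_at_column x' 0 1) => //.
- by apply: (module_at_closed Ax1 Ax0); rewrite ?Ghat_adj_columns //; lia.
- apply: (module_at_closed Ax0 Ax1); rewrite ?Ghat_adj_columns //; first lia.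
  by move=> /esym.
Qed.

Lemma module_at_columns_full x x' y y' : x < x' ->
  module_at x y -> module_at x' y' ->
  forall c w, w < c + 5 -> module_at c w.
Proof.
move=> xx' Ay Ay'; have y'L := module_at_lt Ay'; have yL := module_at_lt Ay.
have [yy' | /eqP yy'] := eqVneq (y %% k) (y' %% k).
  set d := if k == 2 then 3 else 2.
  have d23 : 2 <= d <= 3 by rewrite /d; case: ifP.
  (* If [y' < d], then [y' + d <= 5 < x' + 5], because [x < x'] makes [x'] positive. *)
  have [z [zL zd]] : exists z, z < x' + 5 /\ (y' + d = z \/ z + d = y').
    by case: (leqP d y') => h; [exists (y' - d) | exists (y' + d)]; lia.
  have zy' : z <> y' %[mod k].
    by case: zd => /(modn_far_neq hk) // h /esym.
  suff Az : module_at x' z.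
    by apply: (module_at_column_full Az Ay') => e; apply: zy'; rewrite e.
  (* As [y] and [y'] are congruent, [(x', z)] is adjacent to [(x, y)]; being at distance [d >= 2],
     it is not adjacent to [(x', y')]. *)
  apply: (module_at_closed Ay Ay' zL).
  - by rewrite Ghat_adj_columns; [rewrite yy' | lia].
  - rewrite Ghat_adj_column; lia.
(* A column beyond both [x] and [x'], long enough to contain the heights [y] and [y']. *)
pose c := x' + y + y'.+1.
have Ac y1 : y1 = y \/ y1 = y' -> module_at c y1.
  case=> ->.
  - by apply: (module_at_closed Ay' Ay); rewrite ?Ghat_adj_columns /c //; lia.
  - by apply: (module_at_closed Ay Ay'); rewrite ?Ghat_adj_columns /c //; lia.
apply: (module_at_column_full (Ac y _) (Ac y' _)); [by left | by right |].
by move=> e; apply: yy'; rewrite e.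
Qed.

End ModulesOfQhat.

Lemma Qhat_indecomposable k : 2 <= k -> indecomposable (Qhat k).
Proof.
move=> hk A mA; have [->|/eqP/set0P[u Au]] := pselect (A = set0).
  by constructor 1.
have [A_le1|] := pselect (forall v, A v -> v = u).
  by constructor 2; exists u; apply/seteqP; split=> [v /A_le1|v ->].
move=> /existsNP[v /not_implyP[Av vu]]; constructor 3.
suff full c w : w < c + 5 -> module_at A c w.
  by apply/seteqP; split=> // w _; apply/module_atE/full/(svalP w).
move: u v Au Av vu => [[x y] xyL] [[x' y'] xyL'] Au Av vu.
have {Au}Ay : module_at A x y by exists xyL.
have {Av}Ay' : module_at A x' y' by exists xyL'.
case: (ltngtP x x') => xx'.
- exact: (module_at_columns_full hk mA xx' Ay Ay').
- exact: (module_at_columns_full hk mA xx' Ay' Ay).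
rewrite -{}xx' in xyL' vu Ay'.
apply: (module_at_column_full hk mA Ay Ay') => yy'.
by apply: vu; apply: eq_exist; rewrite yy'.
Qed.

Theorem theorem9 (k : nat) (hk : 2 <= k) : prime_graph (Qhat k).
Proof.
split; first exact: Qhat_indecomposable.
have f_in i : [set v : nat * nat | v.2 < v.1 + 5]%classic (i, 0).
  by rewrite /=; lia.
pose f i : Qhat k := exist _ (i, 0) (f_in i).
have f_inj : injective f by move=> i j /(congr1 sval)[].
apply/card_subP; exists (f @` `I_4)%classic => //.
by apply: inj_card_eq; apply: in2W.
Qed.
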